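(* Let $R_1,R_2$ be $G$-graded commutative rings, $R=R_1\times R_2$, let $M_i$ be a $G$-graded $R_i$-module ($i=1,2$), $M=M_1\times M_2$ the corresponding graded $R$-module, and $s=(s_1,s_2)\in h^*(R)$. Assume that $L=N\times K$ is a graded $R$-submodule of $M$. Then $L\in GSpec_s({}_RM)$ if and only if one of the following holds: (i) $N\in GSpec_{s_1}({}_{R_1}M_1)$ and $s_2\in(K:_{R_2}M_2)$; or (ii) $K\in GSpec_{s_2}({}_{R_2}M_2)$ and $s_1\in(N:_{R_1}M_1)$.
   Context: $G$ is a group with identity $e$; rings are commutative with nonzero unity $1$ and modules are unital. A ring $R$ is $G$-graded if $R=\bigoplus_{g\in G}R_g$ with additive subgroups $R_g$ satisfying $R_gR_h\subseteq R_{gh}$; $h(R)=\bigcup_{g\in G}R_g$ and $h^*(R)=h(R)\setminus\{0\}$. An $R$-module $M$ is $G$-graded if $M=\bigoplus_{g\in G}M_g$ with additive subgroups $M_g$ satisfying $R_gM_h\subseteq M_{gh}$; $h(M)=\bigcup_{g\in G}M_g$. A submodule $N$ of $M$ is graded if $N=\bigoplus_{g\in G}(N\cap M_g)$. Products are graded by $(R_1\times R_2)_g=(R_1)_g\times(R_2)_g$ and $(M_1\times M_2)_g=(M_1)_g\times(M_2)_g$. Write $(N:_RM)=\{r\in R: rM\subseteq N\}$. For a nonzero homogeneous $s\in h^*(R)$, a graded $R$-submodule $N$ of $M$ is graded $s$-prime if $s\notin(N:_RM)$ and, for all $r\in h(R)$ and $m\in h(M)$, $rm\in N$ implies $sr\in(N:_RM)$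 or $sm\in N$; $GSpec_s({}_RM)$ is the set of these (no submodule is graded $0$-prime, since $0\in(N:_RM)$). *)

(* Defs.v *)
From HB Require Import structures.
From mathcomp Require Import all_boot all_algebra.
From mathcomp Require Import boolp classical_sets.

Set Implicit Arguments.
Unset Strict Implicit.
Unset Printing Implicit Defensive.

Import GRing.Theory.
Local Open Scope classical_set_scope.
Local Open Scope ring_scope.

(** Internal direct sums.  The index type may be infinite, so an element of the
    sum is a sum over a finite duplicate-free list of indices. *)
Definition sum_family (I : eqType) (V : zmodType) (A : I -> set V) : set V :=
  [set x | exists s : seq I, exists c : I -> V,
    [/\ uniq s, forall i, i \in s -> A i (c i) & x = \sum_(i <- s) c i]].

Definition independent (I : eqType) (V : zmodType) (A : I -> set V) : Prop :=
  forall (s : seq I) (c : I -> V),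
    uniq s -> (forall i, i \in s -> A i (c i)) ->
    \sum_(i <- s) c i = 0 -> forall i, i \in s -> c i = 0.

Definition direct_sum (I : eqType) (V : zmodType) (A : I -> set V) (N : set V)
  : Prop := N = sum_family A /\ independent A.

Record graded_ring (G : groupType) (R : comNzRingType) (A : G -> set R)
  : Prop := GradedRing {
  graded_ring_sub : forall g, zmod_closed (mem (A g));
  graded_ring_sum : direct_sum A setT;
  graded_ring_mul : forall g h r t, A g r -> A h t -> A (g * h)%g (r * t)
}.

Record graded_module (G : groupType) (R : comNzRingType) (A : G -> set R)
    (M : lmodType R) (B : G -> set M) : Prop := GradedModule {
  graded_module_sub : forall g, zmod_closed (mem (B g));
  graded_module_sum : direct_sum B setT;
  graded_module_scale :
    forall g h r m, A g r -> B h m -> B (g * h)%g (r *: m)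
}.

Definition homog (G : groupType) (V : zmodType) (A : G -> set V) : set V :=
  \bigcup_g A g.

Definition homog_nz (G : groupType) (V : zmodType) (A : G -> set V) : set V :=
  homog A `\ 0.

Definition graded_submodule (G : groupType) (R : comNzRingType)
    (M : lmodType R) (B : G -> set M) (N : set M) : Prop :=
  submod_closed (mem N) /\ direct_sum (fun g => N `&` B g) N.

(** [(N :_R M)] *)
Definition colon (R : comNzRingType) (M : lmodType R) (N : set M) : set R :=
  [set r | forall m : M, N (r *: m)].

(** Meant for nonzero homogeneous [s]; for [s = 0] it is empty, because [0]
    lies in [colon N] for every submodule [N]. *)
Definition GSpec (G : groupType) (R : comNzRingType) (A : G -> set R)
    (M : lmodType R) (B : G -> set M) (s : R) : set (set M) :=
  [set N | [/\ graded_submodule B N,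
               ~ colon N s &
               forall r m, homog A r -> homog B m -> N (r *: m) ->
                 colon N (s * r) \/ N (s *: m)]].

(** [M1 * M2] as a module over [R1 * R2]; the library's scaling on pairs takes
    both factors over the same ring, hence the alias. *)
Definition prod_mod (R1 R2 : comNzRingType) (M1 : lmodType R1)
  (M2 : lmodType R2) : Type := (M1 * M2)%type.

Section ProdMod.
Variables (R1 R2 : comNzRingType) (M1 : lmodType R1) (M2 : lmodType R2).

HB.instance Definition _ := GRing.Zmodule.on (prod_mod M1 M2).

Definition prod_mod_scale (r : R1 * R2) (m : prod_mod M1 M2) : prod_mod M1 M2 :=
  (r.1 *: m.1, r.2 *: m.2).

Fact prod_mod_scaleA a b v :
  prod_mod_scale a (prod_mod_scale b v) = prod_mod_scale (a * b) v.
Proof. by congr pair; rewrite /= scalerA. Qed.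

Fact prod_mod_scale1 : left_id 1 prod_mod_scale.
Proof. by case=> m1 m2; congr pair; rewrite /= scale1r. Qed.

Fact prod_mod_scaleDr : right_distributive prod_mod_scale +%R.
Proof. by move=> a u v; congr pair; rewrite /= scalerDr. Qed.

Fact prod_mod_scaleDl v : {morph prod_mod_scale^~ v : a b / a + b}.
Proof. by move=> a b; congr pair; rewrite /= scalerDl. Qed.

HB.instance Definition _ :=
  GRing.Zmodule_isLmodule.Build (R1 * R2)%type (prod_mod M1 M2)
    prod_mod_scaleA prod_mod_scale1 prod_mod_scaleDr prod_mod_scaleDl.

End ProdMod.

Definition prod_grading (G : groupType) (V1 V2 : Type)
    (A1 : G -> set V1) (A2 : G -> set V2) (g : G) : set (V1 * V2) :=
  A1 g `*` A2 g.

Definition prod_mod_grading (G : groupType) (R1 R2 : comNzRingType)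
    (M1 : lmodType R1) (M2 : lmodType R2)
    (B1 : G -> set M1) (B2 : G -> set M2) : G -> set (prod_mod M1 M2) :=
  prod_grading B1 B2.

Definition prod_submod (R1 R2 : comNzRingType)
    (M1 : lmodType R1) (M2 : lmodType R2)
    (N : set M1) (K : set M2) : set (prod_mod M1 M2) :=
  N `*` K.

(* Main.v *)
(** If [L] is [s]-prime, then [(r, 0) (0, m) = 0] lies in [L] for all homogeneous
    [r] and [m], so that [(s1 r, 0)] lies in [(L : M)] or [(0, s2 m)] lies in [L].
    If some [s2 m] is not in [K], then [s1 r] is in [(N : M1)] for every
    homogeneous [r]; summing over the components of [1] gives [s1] in [(N : M1)].
    Hence [s1] is in [(N : M1)] or [s2] is in [(K : M2)], and not both because
    [s] is not in [(L : M)].  The primeness of the other factor is that of [L]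
    tested on elements [(r, 0)], [(m, 0)] or [(0, r)], [(0, m)]. *)
Require Import Defs.
From HB Require Import structures.
From mathcomp Require Import all_boot all_algebra.
From mathcomp Require Import boolp classical_sets.

Set Implicit Arguments.
Unset Strict Implicit.
Unset Printing Implicit Defensive.

Import GRing.Theory.
Local Open Scope classical_set_scope.
Local Open Scope ring_scope.

(** Passes from the boolean membership [mem N], over which [submod_closed] is stated, to
    propositional membership in [N]. *)
Lemma submod_closedP (R : comNzRingType) (M : lmodType R) (N : set M) :
  submod_closed (mem N) <->
  N 0 /\ forall a u v, N u -> N v -> N (a *: u + v).
Proof.
split=> [[N0 NZ]|[N0 NZ]]; split.
- exact: set_mem.
- by move=> a u v Nu Nv; apply: set_mem; apply: NZ; apply: mem_set.
- exact: mem_set.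
- by move=> a u v /set_mem Nu /set_mem Nv; apply: mem_set; apply: NZ.
Qed.

Section Submodules.
Variables (R : comNzRingType) (M : lmodType R) (N : set M).
Hypothesis Nsub : submod_closed (mem N).

Let N0 : N 0. Proof. by have /submod_closedP[] := Nsub. Qed.

Let NZ a u v : N u -> N v -> N (a *: u + v).
Proof. by have /submod_closedP[_] := Nsub; apply. Qed.

Lemma submod_add u v : N u -> N v -> N (u + v).
Proof. by move=> Nu Nv; rewrite -[u]scale1r; apply: NZ. Qed.

Lemma colon0 : colon N 0.
Proof. by move=> m; rewrite scale0r. Qed.

Lemma colonD r t : colon N r -> colon N t -> colon N (r + t).
Proof. by move=> Nr Nt m; rewrite scalerDl; apply: submod_add. Qed.

Lemma colonMr r t : colon N r -> colon N (r * t).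
Proof. by move=> Nr m; rewrite -scalerA; apply: Nr. Qed.

End Submodules.

(** Every element is a finite sum of homogeneous ones, so an additive property need only be checked
    on those. This extends primeness, which only sees homogeneous elements, to all elements. *)
Lemma homog_ind (G : groupType) (V : zmodType) (A : G -> set V) (P : set V) :
  direct_sum A setT -> P 0 -> (forall x y, P x -> P y -> P (x + y)) ->
  homog A `<=` P -> forall x, P x.
Proof.
move=> [AT _] P0 PD AP x; have : setT x by [].
rewrite AT => -[s [c [_ Ac ->]]]; rewrite big_seq.
by apply: (big_ind P) => // g sg; apply: AP; exists g => //; apply: Ac.
Qed.

Lemma graded_ring0 (G : groupType) (R : comNzRingType) (A : G -> set R)
  (g : G) : graded_ring A -> A g 0.
Proof. by case=> /(_ g) [A0 _] _ _; apply: set_mem. Qed.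

Lemma graded_module0 (G : groupType) (R : comNzRingType) (A : G -> set R)
  (M : lmodType R) (B : G -> set M) (g : G) : graded_module A B -> B g 0.
Proof. by case=> /(_ g) [B0 _] _ _; apply: set_mem. Qed.

Lemma sum_family_image (I : eqType) (V W : zmodType) (f : {additive V -> W})
    (A : I -> set V) (B : I -> set W) :
  (forall i, f @` A i `<=` B i) -> f @` sum_family A `<=` sum_family B.
Proof.
move=> AB _ [_ [s [c [us Ac ->]]] <-]; exists s, (f \o c); split=> //.
- by move=> i si; apply: AB; exists (c i) => //; apply: Ac.
- by rewrite raddf_sum.
Qed.

(** Independence is inherited from [B], and sums of elements of [N] stay in [N]; only the existence
    of decompositions inside [N] is left to check. *)
Lemma graded_submoduleP (G : groupType) (R : comNzRingType) (A : G -> set R)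
    (M : lmodType R) (B : G -> set M) (N : set M) :
  graded_module A B -> submod_closed (mem N) ->
  N `<=` sum_family (fun g => N `&` B g) -> graded_submodule B N.
Proof.
move=> [_ [_ Bind] _] Nsub NB; split=> //; split.
- apply/seteqP; split=> // _ [s [c [_ Nc ->]]]; rewrite big_seq.
  apply: (big_ind N) => [|x y|g /Nc[]//]; last exact: submod_add.
  by have /submod_closedP[] := Nsub.
- by move=> s c us Nc; apply: Bind => // g /Nc[].
Qed.

Section Product.
Variables (G : groupType) (R1 R2 : comNzRingType).
Variables (A1 : G -> set R1) (A2 : G -> set R2).
Variables (M1 : lmodType R1) (M2 : lmodType R2).
Variables (B1 : G -> set M1) (B2 : G -> set M2).
Hypotheses (hA1 : graded_ring A1) (hA2 : graded_ring A2).
Hypotheses (hB1 : graded_module A1 B1) (hB2 : graded_module A2 B2).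
Variables (N : set M1) (K : set M2).

Local Notation A := (prod_grading A1 A2).
Local Notation B := (prod_mod_grading B1 B2).
Local Notation L := (prod_submod N K).

Lemma colon_prod r1 r2 : colon L (r1, r2) <-> colon N r1 /\ colon K r2.
Proof.
split=> [Lr|[Nr Kr] m]; last by split; [apply: Nr|apply: Kr].
by split=> m; [case: (Lr (m, 0))|case: (Lr (0, m))].
Qed.

Lemma submod_closed_prod :
  submod_closed (mem L) -> submod_closed (mem N) /\ submod_closed (mem K).
Proof.
move=> /submod_closedP[[/= N0 K0] LZ]; split; apply/submod_closedP; split=> //.
- by move=> a u v Nu Nv; case: (LZ (a, 0) (u, 0) (v, 0)).
- by move=> a u v Ku Kv; case: (LZ (0, a) (0, u) (0, v)).
Qed.

(** An element [x] of a factor is padded with [0] to an element of [L], decomposed there, and the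
    decomposition is projected back by [fst] or [snd]. *)
Lemma graded_submodule_prod :
  graded_submodule B L -> graded_submodule B1 N /\ graded_submodule B2 K.
Proof.
move=> [Lsub [LB _]]; have [Nsub Ksub] := submod_closed_prod Lsub.
have /submod_closedP[[/= N0 K0] _] := Lsub.
split; [apply: graded_submoduleP hB1 Nsub _|apply: graded_submoduleP hB2 Ksub _].
- move=> x Nx; have : L (x, 0) by [].
  rewrite LB => Lx.
  apply: (@sum_family_image _ _ _ (fst : {additive M1 * M2 -> M1})
            (fun g => L `&` B g)); last by exists (x, 0).
  by move=> g _ [y [[Ny _] [By _]] <-].
- move=> x Kx; have : L (0, x) by [].
  rewrite LB => Lx.
  apply: (@sum_family_image _ _ _ (snd : {additive M1 * M2 -> M2})
            (fun g => L `&` B g)); last by exists (0, x).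
  by move=> g _ [y [[_ Ky] [_ By]] <-].
Qed.

Lemma homog_prodl r : homog A1 r -> homog A (r, 0).
Proof. by move=> [g _ Ar]; exists g => //; split=> //; apply: graded_ring0. Qed.

Lemma homog_prodr r : homog A2 r -> homog A (0, r).
Proof. by move=> [g _ Ar]; exists g => //; split=> //; apply: graded_ring0. Qed.

Lemma homog_prod_modl m : homog B1 m -> homog B (m, 0).
Proof.
by move=> [g _ Bm]; exists g => //; split=> //; apply: graded_module0 hB2.
Qed.

Lemma homog_prod_modr m : homog B2 m -> homog B (0, m).
Proof.
by move=> [g _ Bm]; exists g => //; split=> //; apply: graded_module0 hB1.
Qed.

End Product.

Theorem proposition3p13 (G : groupType) (R1 R2 : comNzRingType)
    (A1 : G -> set R1) (A2 : G -> set R2)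
    (M1 : lmodType R1) (M2 : lmodType R2)
    (B1 : G -> set M1) (B2 : G -> set M2)
    (hA1 : graded_ring A1) (hA2 : graded_ring A2)
    (hB1 : graded_module A1 B1) (hB2 : graded_module A2 B2)
    (s1 : R1) (s2 : R2)
    (hs : homog_nz (prod_grading A1 A2) (s1, s2))
    (N : set M1) (K : set M2)
    (hL : graded_submodule (prod_mod_grading B1 B2) (prod_submod N K)) :
  GSpec (prod_grading A1 A2) (prod_mod_grading B1 B2) (s1, s2)
        (prod_submod N K)
  <->
  (GSpec A1 B1 s1 N /\ colon K s2) \/ (GSpec A2 B2 s2 K /\ colon N s1).
Proof.
have [hN hK] := graded_submodule_prod hB1 hB2 hL.
have [[Nsub _] [Ksub _]] := (hN, hK).
have /submod_closedP[N0 _] := Nsub; have /submod_closedP[K0 _] := Ksub.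
split=> [[_ Ls Lprime]|[[[_ Ns Nprime] Ks]|[[_ Ks Kprime] Ns]]]; last first.
(* Converse, case (ii): since [s1] is in [colon N], the first coordinate satisfies both
   alternatives, so primeness of [K] decides. *)
- split=> // [/colon_prod[]//|[r1 r2] [m1 m2]].
  move=> [g _ [/= _ Ar]] [h _ [/= _ Bm]] [/= _ Krm].
  have [Ksr|Ksm] := Kprime r2 m2 (ex_intro2 _ _ g I Ar) (ex_intro2 _ _ h I Bm) Krm.
    by left; apply/colon_prod; split=> //; apply: colonMr.
  by right; split=> //; apply: Ns.
- split=> // [/colon_prod[]//|[r1 r2] [m1 m2]].
  move=> [g _ [/= Ar _]] [h _ [/= Bm _]] [/= Nrm _].
  have [Nsr|Nsm] := Nprime r1 m1 (ex_intro2 _ _ g I Ar) (ex_intro2 _ _ h I Bm) Nrm.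
    by left; apply/colon_prod; split=> //; apply: colonMr.
  by right; split=> //; apply: Ks.
have [Ks|nKs] := pselect (colon K s2).
  left; split=> //; split=> // [Ns|r m Ar Bm Nrm].
    (* With [Ks], having [s1] in [colon N] would put [(s1, s2)] in [colon L]. *)
    by apply: Ls; apply/colon_prod.
  have [||||[]] := Lprime (r, 0) (m, 0).
  - exact: homog_prodl.
  - exact: homog_prod_modl hB2 _ Bm.
  - by split=> //=; rewrite scale0r.
  - by move=> /colon_prod[]; left.
  - by right.
have Ns : colon N s1.
  (* Assuming [s1] is not in [colon N], the property [K (s2 *: m)] is proved for all [m] by
     reduction to homogeneous [m]. *)
  apply: contrapT => nNs; apply: nKs.
  apply: (homog_ind (graded_module_sum hB2)) => [|x y Kx Ky|m Bm].
  - by rewrite scaler0.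
  - by rewrite scalerDr; apply: submod_add.
  (* With a homogeneous [m] violating the property fixed, [s1] is written as [s1 * 1] and [1] is
     generalised, so that [homog_ind] reduces the claim to homogeneous [r]. *)
  apply: contrapT => nKsm; apply: nNs; rewrite -[s1]mulr1; move: 1.
  apply: (homog_ind (graded_ring_sum hA1)) => [|x y Nx Ny|r Ar].
  - by rewrite mulr0; apply: colon0.
  - by rewrite mulrDr; apply: colonD.
  have [||||[]//] := Lprime (r, 0) (0, m).
  - exact: homog_prodl.
  - exact: homog_prod_modr hB1 _ Bm.
  - by split=> /=; rewrite ?scaler0 ?scale0r.
  - by move=> /colon_prod[].
(* Here [nKs] itself says that [s2] is not in [colon K]. *)
right; split=> //; split=> // r m Ar Bm Krm.
have [||||[]] := Lprime (0, r) (0, m).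
- exact: homog_prodr.
- exact: homog_prod_modr hB1 _ Bm.
- by split=> //=; rewrite scale0r.
- by move=> /colon_prod[]; left.
- by right.
Qed.
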